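(* Let $L_0$ be a countable language which conforms to classical logic and has no truth predicate. Let $\mathcal L_T$ be the extension of $L_0$ defined in the context, built from the smallest consistent subset $U$ of $\mathcal D$ with $U=G(U)$, and valuate the sentences of $\mathcal L_T$ so that a sentence is true iff it is in $L(U)$ and false iff it is in $F(U)$. Then $\mathcal L_T$ has the closure property, satisfies the classical truth rules and is bivalent, and $\mathcal L_T$ has a definitional theory of truth. Moreover, $T$ is a truth predicate and $\neg T$ is a non-truth predicate for $\mathcal L_T$.
   Context: LANGUAGES. A language is a nonempty countable set of sentences of finite length, formed from a countable set of elements, with syntax rules for constructing well-formed sentences and formulas. Three properties of a language are used. Closure property: the language contains $\neg,\vee,\wedge,\rightarrow,\leftrightarrow,\forall,\exists$, and if $A,B$ are sentences of it, so are $\neg A$, $A\vee B$, $A\wedge B$, $A\rightarrow B$, $A\leftrightarrow B$. If $P(x_1,\dots,x_m)$, $m\ge 1$, is a formula of the language with $m$ free variables, then $P$ is called a predicate with arity $m$ and domain $D_P=D_P^1\times\cdots\times D_P^m$, each $D_P^i$ being a subset of a set $D$ of objects (the domain of discourse), if every object of $D$ is named by a term ($N_P^i$ denotes the set of terms naming the objects of $D_P^i$, and $N_P=N_P^1\times\cdots\times N_P^m$), and if for all $b_i\in N_P^i$ the expression $P(b_1,\dots,b_m)$, obtained by substituting $b_i$ for every free occurrence of $x_i$, is a sentence of the language. If $P$ is a predicate with arity $m\ge1$, then all sentences $q_1x_1\dots q_mx_mP(x_1,\dots,x_m)$, each $q_i$ being $\forall$ or $\exists$, are in the language, and $\neg P$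 is also a predicate with arity $m$ and domain $D_P$. Classical truth rules: sentences are so valuated as true or as false that $A$ is true iff $\neg A$ is false, and $A$ is false iff $\neg A$ is true; $A\vee B$ is true iff $A$ or $B$ is true, and false iff both are false; $A\wedge B$ is true iff both are true, and false iff $A$ or $B$ is false; $A\rightarrow B$ is true iff $A$ is false or $B$ is true, and false iff $A$ is true and $B$ is false; $A\leftrightarrow B$ is true iff $A,B$ are both true or both false, and false iff one is true and the other false; for a predicate $P$ with arity $m$, $q_1x_1\dots q_mx_mP(x_1,\dots,x_m)$ is true iff $P(b_1,\dots,b_m)$ is true for all $b_i\in N_P^i$ when $q_i$ is $\forall$, and for some $b_i\in N_P^i$ when $q_i$ is $\exists$; it is false iff $P(b_1,\dots,b_m)$ is false for all $b_i\in N_P^i$ when $q_i$ is $\exists$, and for some $b_i\in N_P^i$ when $q_i$ is $\forall$. Bivalence: every sentence of the language is either true or false. A language conforms to classical logic if it has, or can be extended to have, these three properties. TRUTH. A truth predicate of a language is a predicate $T$ such that $T(\lceil A\rceil)\leftrightarrow A$ is true for every sentence $A$ of the language, where the term $\lceil A\rceil$ names $A$. A language has a theory of truth if truth values are assigned to its sentences and it contains a truth predicate; the theory is definitional if the truth values are defined for sentences. ''$\neg T$ is a non-truth predicate'' means that $\neg T(\lceil A\rceil)\leftrightarrow A$ is false for every sentence $A$ of the language. CONSTRUCTION. Let $L$ be a basic extension of $L_0$, i.e. an extension having the three properties. The language $L_T$ (distinct from $\mathcal L_T$ below) is formed by adding to $L$ extra formulas $T(x)$, $\neg T(x)$ and sentences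 $T(\mathbf n)$, $\neg T(\mathbf n)$ for all numerals $\mathbf n$ of numbers $n\in\mathbb N_0=\{0,1,2,\dots\}$ (numerals are added to the terms if necessary). Fix a Gödel numbering of sentences; $\#A$ is the Gödel number of $A$ and $\lceil A\rceil$ is the numeral of $\#A$. For each predicate $P$ of $L$ with arity $m$ add the predicates $T(\lceil P(\dot x_1,\dots,\dot x_m)\rceil)$ and $\neg T(\lceil P(\dot x_1,\dots,\dot x_m)\rceil)$ with domain $D_P$, whose sentences at $(b_1,\dots,b_m)\in N_P$ are $T(\lceil P(b_1,\dots,b_m)\rceil)$ and $\neg T(\lceil P(b_1,\dots,b_m)\rceil)$; similarly the sentence of $T_1(\lceil T_2(\dot x)\rceil)$ at $\mathbf n$ is $T_1(\lceil T_2(\mathbf n)\rceil)$. Adding the sentences $\forall xT_1(x)$, $\exists xT_1(x)$, $\forall xT_1(\lceil T_2(\dot x)\rceil)$, $\exists xT_1(\lceil T_2(\dot x)\rceil)$ for $T_1,T_2\in\{T,\neg T\}$, and $q_1x_1\dots q_mx_mT(\lceil P(\dot x_1,\dots,\dot x_m)\rceil)$, $q_1x_1\dots q_mx_m\neg T(\lceil P(\dot x_1,\dots,\dot x_m)\rceil)$ for each predicate $P$ of $L$ with arity $m\ge1$ and all $q_i\in\{\forall,\exists\}$, gives a language $\mathcal L_0$. $\mathcal L_{n+1}$ is obtained from $\mathcal L_n$ by adding $\neg A$, $A\vee B$, $A\wedge B$, $A\rightarrow B$, $A\leftrightarrow B$ for all sentences $A,B$ of $\mathcal L_n$; $\mathcal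 L=\bigcup_n\mathcal L_n$. The Gödel numbering is extended to $\mathcal L$, and $\mathcal D$ is the set of Gödel numbers of sentences of $\mathcal L$. Let $\mathcal P^m$ be the set of predicates of $L$ with arity $m$ and $\mathcal P=\bigcup_{m\ge1}\mathcal P^m$. Put $Z=\{A: A$ is a true sentence of $L\}$; $Z_1(U)=\{T(\mathbf n):\mathbf n=\lceil A\rceil$, $A$ a sentence of $\mathcal L$, $\#A\in U\}$; $Z_2(U)=\{\neg T(\mathbf n):\mathbf n=\lceil A\rceil$, $A$ a sentence of $\mathcal L$, $\#[\neg A]\in U\}$; $Z_1=\{\neg\forall xT(x),\exists xT(x),\neg\forall x\neg T(x),\exists x\neg T(x)\}$; $Z_2=\{\neg(\forall xT_1(\lceil T_2(\dot x)\rceil)),\ \exists xT_1(\lceil T_2(\dot x)\rceil): T_1,T_2\in\{T,\neg T\}\}$; $Z_3=\bigcup_m\{q_1x_1\dots q_mx_mT(\lceil P(\dot x_1,\dots,\dot x_m)\rceil): P\in\mathcal P^m,\ q_1x_1\dots q_mx_mP(x_1,\dots,x_m)$ is true$\}$; $Z_4=\bigcup_m\{q_1x_1\dots q_mx_m\neg T(\lceil P(\dot x_1,\dots,\dot x_m)\rceil): P\in\mathcal P^m,\ q_1x_1\dots q_mx_m\neg P(x_1,\dots,x_m)$ is true$\}$. Set $L_0(\emptyset)=Z$ and $L_0(U)=Z\cup Z_1(U)\cup Z_2(U)\cup Z_1\cup Z_2\cup Z_3\cup Z_4$ for nonempty proper subsets $U$ of $\mathcal D$. Given $L_n(U)$,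 with $A,B$ ranging over sentences of $\mathcal L$, $L_{n+1}(U)$ is $L_n(U)$ together with all: $\neg(\neg A)$ with $A\in L_n(U)$; $A\vee B$ with ($A$ and $B$) or ($A$ and $\neg B$) or ($\neg A$ and $B$) in $L_n(U)$; $A\wedge B$ with $A,B\in L_n(U)$; $A\rightarrow B$ with ($\neg A$ and $B$) or ($\neg A$ and $\neg B$) or ($A$ and $B$) in $L_n(U)$; $A\leftrightarrow B$ with ($A$ and $B$) or ($\neg A$ and $\neg B$) in $L_n(U)$; $\neg(A\vee B)$ with $\neg A,\neg B\in L_n(U)$; $\neg(A\wedge B)$ with ($\neg A$ and $B$) or ($\neg A$ and $\neg B$) or ($A$ and $\neg B$) in $L_n(U)$; $\neg(A\rightarrow B)$ with $A,\neg B\in L_n(U)$; $\neg(A\leftrightarrow B)$ with ($A$ and $\neg B$) or ($\neg A$ and $B$) in $L_n(U)$. Put $L(U)=\bigcup_{n\ge0}L_n(U)$, $G(U)=\{\#A: A\in L(U)\}$, $F(U)=\{A:\neg A\in L(U)\}$. A subset $U$ of $\mathcal D$ is consistent if for no sentence $A$ of $\mathcal L$ both $\#A$ and $\#[\neg A]$ are in $U$. A smallest (with respect to inclusion) consistent $U\subset\mathcal D$ with $U=G(U)$ exists. THE LANGUAGE $\mathcal L_T$. Let $U$ be that smallest set. $\mathcal L_T$ is formed by $L_0$, the predicates of $\mathcal P$, the sentences of $L(U)$ and $F(U)$, the formulas $T(x)$, $\neg T(x)$ with corresponding predicates $T$, $\neg T$ having domain $D_T=L(U)\cup F(U)$ and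 set of terms $N_T=\{\mathbf n:\mathbf n=\lceil A\rceil$, $A\in D_T\}$, and the predicates $T_1(\lceil T_2(\dot x)\rceil)$ and $T_1(\lceil P(\dot x_1,\dots,\dot x_m)\rceil)$, where $T_1,T_2\in\{T,\neg T\}$ and $P\in\mathcal P$ has arity $m\ge1$.
   Formalization: As written closure fails: when q x P is false neither q x T(⌈P⌉) nor its negation is in L(U), and ¬¬T is no predicate of L_T. So Z_3, Z_4 are completed by the negations of their sentences whose L-counterparts are false, and double negations of the added predicates cancel. *)

(* Defs.v *)
From mathcomp Require Import all_boot all_classical.

Set Implicit Arguments.
Unset Strict Implicit.
Unset Printing Implicit Defensive.

Local Open Scope classical_set_scope.

Inductive quantifier := Qall | Qex.

Definition qdual (q : quantifier) : quantifier :=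
  match q with Qall => Qex | Qex => Qall end.

(* The expressions over which a language and its extensions are formed.
   [formula m] consists of the formulas with m free variables x_1, ..., x_m,
   [inst P b] is P(b_1, ..., b_m) and [quant q P] is
   q_1 x_1 ... q_m x_m P(x_1, ..., x_m).
   A language (below) selects which expressions are its sentences, formulas
   and terms. *)
Structure syntax := Syntax {
  expr : Type;
  term : Type;
  object : Type;
  formula : nat -> Type;
  neg : expr -> expr;
  disj : expr -> expr -> expr;
  conj : expr -> expr -> expr;
  impl : expr -> expr -> expr;
  equi : expr -> expr -> expr;
  inst : forall m, formula m -> m.-tuple term -> expr;
  quant : forall m, m.-tuple quantifier -> formula m -> expr;
  fneg : forall m, formula m -> formula m;
  (* Substitution commutes with negation.  The second alternative allows
     double negations in front of a formula to be cancelled, so that the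
     negation of the formula ~Q may be Q. *)
  inst_fneg : forall m (P : formula m),
    (forall b, inst (fneg P) b = neg (inst P b)) \/
    (forall b, inst P b = neg (inst (fneg P) b));
  numeral : nat -> term;
  numeral_inj : injective numeral;
  (* an expression regarded as an object, so that terms can name sentences *)
  expr_object : expr -> object;
  expr_object_inj : injective expr_object
}.

Record language (S : syntax) := Language {
  sentence : set (expr S);
  is_formula : forall m, set (formula S m);
  is_term : set (term S);
  names : term S -> object S -> Prop;
  dom : forall m, formula S m -> 'I_m -> set (object S);
  is_true_in : set (expr S);
  is_false_in : set (expr S);
  true_sentence : is_true_in `<=` sentence;
  false_sentence : is_false_in `<=` sentence
}.

Section Languages.
Variable S : syntax.
Implicit Types L : language S.

(* Sentences, formulas and terms are finite expressions formed from a countable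
   set of elements; what is retained of this is countability. *)
Definition countable_language L : Prop :=
  [/\ sentence L !=set0, countable (sentence L),
      forall m, countable (@is_formula S L m) & countable (is_term L)].

(* N_P^i *)
Definition term_dom L m (P : formula S m) (i : 'I_m) : set (term S) :=
  [set t | is_term L t /\ exists2 o, dom L P i o & names L t o].

Definition predicate L m (P : formula S m) : Prop :=
  [/\ (0 < m)%N, is_formula L P,
      exists D : set (object S),
        (forall i, dom L P i `<=` D) /\
        (forall o, D o -> exists2 t, is_term L t & names L t o)
    & forall b : m.-tuple (term S),
        (forall i, term_dom L P i (tnth b i)) -> sentence L (inst P b)].

(* q_1 b_1 in N_1, ..., q_m b_m in N_m, Q (b_1, ..., b_m) *)
Fixpoint bounded_quant (T : Type) (m : nat) :
    m.-tuple quantifier -> ('I_m -> set T) -> (m.-tuple T -> Prop) -> Prop :=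
  match m with
  | 0 => fun _ _ Q => Q [tuple]
  | k.+1 => fun q N Q =>
      let rest b := bounded_quant (behead_tuple q)
                      (fun i => N (lift ord0 i))
                      (fun bs => Q (cons_tuple b bs)) in
      match thead q with
      | Qall => forall b, N ord0 b -> rest b
      | Qex => exists b, N ord0 b /\ rest b
      end
  end.

Definition closure_property L : Prop :=
  [/\ forall A, sentence L A -> sentence L (neg A),
      forall A B, sentence L A -> sentence L B ->
        [/\ sentence L (disj A B), sentence L (conj A B),
            sentence L (impl A B) & sentence L (equi A B)]
    & forall m (P : formula S m), predicate L P ->
        [/\ forall q : m.-tuple quantifier, sentence L (quant q P),
            predicate L (fneg P)
          & forall i, dom L (fneg P) i = dom L P i]].

Definition truth_rules L : Prop :=
  let tr := is_true_in L in
  let fl := is_false_in L in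
  (forall A, sentence L A ->
     (tr A <-> fl (neg A)) /\ (fl A <-> tr (neg A))) /\
  (forall A B, sentence L A -> sentence L B ->
     (tr (disj A B) <-> tr A \/ tr B) /\
     (fl (disj A B) <-> fl A /\ fl B)) /\
  (forall A B, sentence L A -> sentence L B ->
     (tr (conj A B) <-> tr A /\ tr B) /\
     (fl (conj A B) <-> fl A \/ fl B)) /\
  (forall A B, sentence L A -> sentence L B ->
     (tr (impl A B) <-> fl A \/ tr B) /\
     (fl (impl A B) <-> tr A /\ fl B)) /\
  (forall A B, sentence L A -> sentence L B ->
     (tr (equi A B) <-> (tr A /\ tr B) \/ (fl A /\ fl B)) /\
     (fl (equi A B) <-> (tr A /\ fl B) \/ (fl A /\ tr B))) /\
  (forall m (P : formula S m) (q : m.-tuple quantifier), predicate L P ->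
     (tr (quant q P) <->
        bounded_quant q (term_dom L P) (fun b => tr (inst P b))) /\
     (fl (quant q P) <->
        bounded_quant (map_tuple qdual q) (term_dom L P)
          (fun b => fl (inst P b)))).

Definition bivalent L : Prop :=
  forall A, sentence L A ->
    (is_true_in L A \/ is_false_in L A) /\
    ~ (is_true_in L A /\ is_false_in L A).

Definition extends L0 L : Prop :=
  sentence L0 `<=` sentence L /\
  (forall m, @is_formula S L0 m `<=` @is_formula S L m) /\
  is_term L0 `<=` is_term L /\
  (forall t o, is_term L0 t -> names L0 t o -> names L t o) /\
  (forall m (P : formula S m), is_formula L0 P ->
     forall i, dom L P i = dom L0 P i) /\
  is_true_in L0 `<=` is_true_in L /\
  is_false_in L0 `<=` is_false_in L.

Definition basic_extension L0 L : Prop :=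
  [/\ countable_language L, extends L0 L, closure_property L, truth_rules L
    & bivalent L].

Definition conforms_to_classical_logic L0 : Prop :=
  exists L, basic_extension L0 L.

(* [corner A] is the term naming the sentence A *)
Definition naming_of_sentences L (T : formula S 1)
    (corner : expr S -> term S) : Prop :=
  forall A, sentence L A ->
    names L (corner A) (expr_object A) /\ term_dom L T ord0 (corner A).

Definition truth_predicate L (T : formula S 1)
    (corner : expr S -> term S) : Prop :=
  [/\ predicate L T, naming_of_sentences L T corner
    & forall A, sentence L A ->
        is_true_in L (equi (inst T [tuple corner A]) A)].

Definition nontruth_predicate L (T : formula S 1)
    (corner : expr S -> term S) : Prop :=
  [/\ predicate L T, naming_of_sentences L T corner
    & forall A, sentence L A ->
        is_false_in L (equi (inst T [tuple corner A]) A)].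

Definition has_truth_predicate L : Prop :=
  exists T corner, truth_predicate L T corner.

Definition theory_of_truth L : Prop :=
  (forall A, sentence L A -> is_true_in L A \/ is_false_in L A) /\
  has_truth_predicate L.

Definition has_truth_value L (A : expr S) (v : bool) : Prop :=
  if v then is_true_in L A else is_false_in L A.

Definition definitional_theory_of_truth L : Prop :=
  theory_of_truth L /\
  (forall A, sentence L A -> exists! v : bool, has_truth_value L A v).

End Languages.

(* The sign of a formula T(x) or ~T(x). *)
Inductive tsign := Pos | Neg.

Definition tsign_neg (s : tsign) : tsign :=
  match s with Pos => Neg | Neg => Pos end.

(* Expressions over S extended by a new symbol T.  Compounds of expressions of
   S are again expressions of S, so the constructors EDisj, ... only
   represent compounds with at least one part not in S; see tdisj, ... *)
Inductive texpr (S : syntax) : Type :=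
| EBase of expr S
| ET of term S                                       (* T(t) *)
| EQT of quantifier & tsign                          (* qx T_1(x) *)
| EQTT of quantifier & tsign & tsign                 (* qx T_1([T_2(x.)]) *)
| EQTP m of m.-tuple quantifier & tsign & formula S m
    (* q_1 x_1 ... q_m x_m T_1([P(x_1., ..., x_m.)]) *)
| ENeg of texpr S
| EDisj of texpr S & texpr S
| EConj of texpr S & texpr S
| EImpl of texpr S & texpr S
| EEqui of texpr S & texpr S.

Arguments ET {S}.
Arguments EQT {S}.
Arguments EQTT {S}.

Inductive tformula (S : syntax) : nat -> Type :=
| FBase m of formula S m : tformula S m
| FT of tsign : tformula S 1                         (* T_1(x) *)
| FTT of tsign & tsign : tformula S 1                (* T_1([T_2(x.)]) *)
| FTP m of tsign & formula S m : tformula S m.       (* T_1([P(x_1., ...)]) *)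

Arguments FT {S}.
Arguments FTT {S}.

Section TSyntax.
Variable S : syntax.
Variable gn : texpr S -> nat.                        (* Goedel numbering *)

Definition tneg (A : texpr S) : texpr S :=
  match A with EBase a => EBase (neg a) | _ => ENeg A end.
Definition tdisj (A B : texpr S) : texpr S :=
  match A, B with EBase a, EBase b => EBase (disj a b) | _, _ => EDisj A B end.
Definition tconj (A B : texpr S) : texpr S :=
  match A, B with EBase a, EBase b => EBase (conj a b) | _, _ => EConj A B end.
Definition timpl (A B : texpr S) : texpr S :=
  match A, B with EBase a, EBase b => EBase (impl a b) | _, _ => EImpl A B end.
Definition tequi (A B : texpr S) : texpr S :=
  match A, B with EBase a, EBase b => EBase (equi a b) | _, _ => EEqui A B end.

Definition corner (A : texpr S) : term S := numeral S (gn A).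

(* T(t) or ~T(t) *)
Definition tlit (s : tsign) (t : term S) : texpr S :=
  match s with Pos => ET t | Neg => tneg (ET t) end.

Definition tinst m (P : tformula S m) : m.-tuple (term S) -> texpr S :=
  match P in tformula _ m return m.-tuple (term S) -> texpr S with
  | FBase _ P => fun b => EBase (inst P b)
  | FT s => fun b => tlit s (thead b)
  | FTT s1 s2 => fun b => tlit s1 (corner (tlit s2 (thead b)))
  | FTP _ s P => fun b => tlit s (corner (EBase (inst P b)))
  end.

Definition tquant m (q : m.-tuple quantifier) (P : tformula S m) : texpr S :=
  match P in tformula _ m return m.-tuple quantifier -> texpr S with
  | FBase _ P => fun q => EBase (quant q P)
  | FT s => fun q => EQT (thead q) s
  | FTT s1 s2 => fun q => EQTT (thead q) s1 s2
  | FTP _ s P => fun q => EQTP q s P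
  end q.

Definition tfneg m (P : tformula S m) : tformula S m :=
  match P in tformula _ m return tformula S m with
  | FBase _ P => FBase (fneg P)
  | FT s => FT (tsign_neg s)
  | FTT s1 s2 => FTT (tsign_neg s1) s2
  | FTP _ s P => FTP (tsign_neg s) P
  end.

Lemma tinst_tfneg m (P : tformula S m) :
  (forall b, tinst (tfneg P) b = tneg (tinst P b)) \/
  (forall b, tinst P b = tneg (tinst (tfneg P) b)).
Proof.
case: P => {m} [m P|[]|[] s2|m [] P] /=; try by [left|right].
by case: (inst_fneg P) => h; [left|right] => b; rewrite /= h.
Qed.

Definition tsyntax : syntax :=
  @Syntax (texpr S) (term S) (object S + texpr S) (tformula S)
    tneg tdisj tconj timpl tequi tinst tquant tfneg tinst_tfneg
    (numeral S) (@numeral_inj S) inr (fun _ _ => @inr_inj _ _ _ _).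

End TSyntax.

Section Construction.
Variables (S : syntax) (L : language S) (gn : texpr S -> nat).

Notation "[# A ]" := (corner gn A).

Inductive calL0 : texpr S -> Prop :=
| calL0_base A of sentence L A : calL0 (EBase A)
| calL0_T s n : calL0 (tlit s (numeral S n))
| calL0_QT q s : calL0 (EQT q s)
| calL0_QTT q s1 s2 : calL0 (EQTT q s1 s2)
| calL0_QTP m (q : m.-tuple quantifier) s (P : formula S m) of
    predicate L P : calL0 (EQTP q s P).

Inductive calL_step (X : set (texpr S)) : texpr S -> Prop :=
| calL_old A of X A : calL_step X A
| calL_neg A of X A : calL_step X (tneg A)
| calL_disj A B of X A & X B : calL_step X (tdisj A B)
| calL_conj A B of X A & X B : calL_step X (tconj A B)
| calL_impl A B of X A & X B : calL_step X (timpl A B)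
| calL_equi A B of X A & X B : calL_step X (tequi A B).

Definition calLn (n : nat) : set (texpr S) := iter n calL_step calL0.

Definition calL : set (texpr S) := \bigcup_n calLn n.

Definition goedel_numbering : Prop :=
  forall A B, calL A -> calL B -> gn A = gn B -> A = B.

Definition calD : set nat := gn @` calL.

Definition setZ : set (texpr S) := @EBase S @` is_true_in L.

Definition setZ1U (U : set nat) : set (texpr S) :=
  [set X | exists A, [/\ calL A, U (gn A) & X = ET [# A]]].

Definition setZ2U (U : set nat) : set (texpr S) :=
  [set X | exists A, [/\ calL A, U (gn (tneg A)) & X = tneg (ET [# A])]].

Definition setZ1 : set (texpr S) :=
  [set X | exists s, X = tneg (EQT Qall s) \/ X = EQT Qex s].

Definition setZ2 : set (texpr S) :=
  [set X | exists s1 s2, X = tneg (EQTT Qall s1 s2) \/ X = EQTT Qex s1 s2].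

Definition setZ3 : set (texpr S) :=
  [set X | exists m (P : formula S m) q,
     [/\ predicate L P, is_true_in L (quant q P) & X = EQTP q Pos P]].

Definition setZ4 : set (texpr S) :=
  [set X | exists m (P : formula S m) q,
     [/\ predicate L P, is_true_in L (quant q (fneg P)) & X = EQTP q Neg P]].

(* The negations of the sentences of the forms occurring in setZ3 and setZ4
   that are not in these sets.  As in setZ1 and setZ2, each quantified sentence
   or its negation has to be present initially: no rule of stage_step yields
   the negation of a quantified sentence. *)
Definition setZ3neg : set (texpr S) :=
  [set X | exists m (P : formula S m) q,
     [/\ predicate L P, is_false_in L (quant q P) & X = tneg (EQTP q Pos P)]].

Definition setZ4neg : set (texpr S) :=
  [set X | exists m (P : formula S m) q,
     [/\ predicate L P, is_false_in L (quant q (fneg P))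
       & X = tneg (EQTP q Neg P)]].

(* Only used for proper subsets U of calD. *)
Definition stage0 (U : set nat) : set (texpr S) :=
  [set X | setZ X \/
     (U !=set0 /\
      (setZ1U U `|` setZ2U U `|` setZ1 `|` setZ2 `|`
       (setZ3 `|` setZ3neg) `|` (setZ4 `|` setZ4neg)) X)].

Inductive stage_step (W : set (texpr S)) : texpr S -> Prop :=
| stage_old X of W X : stage_step W X
| stage_negneg A of calL A & W A : stage_step W (tneg (tneg A))
| stage_disj A B of calL A & calL B &
    (W A /\ W B) \/ (W A /\ W (tneg B)) \/ (W (tneg A) /\ W B) :
    stage_step W (tdisj A B)
| stage_conj A B of calL A & calL B & W A /\ W B :
    stage_step W (tconj A B)
| stage_impl A B of calL A & calL B &
    (W (tneg A) /\ W B) \/ (W (tneg A) /\ W (tneg B)) \/ (W A /\ W B) :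
    stage_step W (timpl A B)
| stage_equi A B of calL A & calL B &
    (W A /\ W B) \/ (W (tneg A) /\ W (tneg B)) :
    stage_step W (tequi A B)
| stage_neg_disj A B of calL A & calL B & W (tneg A) /\ W (tneg B) :
    stage_step W (tneg (tdisj A B))
| stage_neg_conj A B of calL A & calL B &
    (W (tneg A) /\ W B) \/ (W (tneg A) /\ W (tneg B)) \/ (W A /\ W (tneg B)) :
    stage_step W (tneg (tconj A B))
| stage_neg_impl A B of calL A & calL B & W A /\ W (tneg B) :
    stage_step W (tneg (timpl A B))
| stage_neg_equi A B of calL A & calL B &
    (W A /\ W (tneg B)) \/ (W (tneg A) /\ W B) :
    stage_step W (tneg (tequi A B)).

Definition stage (U : set nat) (n : nat) : set (texpr S) :=
  iter n stage_step (stage0 U).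

Definition LU (U : set nat) : set (texpr S) := \bigcup_n stage U n.

Definition GU (U : set nat) : set nat := gn @` LU U.

Definition FU (U : set nat) : set (texpr S) :=
  [set A | calL A /\ LU U (tneg A)].

Definition consistent (U : set nat) : Prop :=
  ~ exists A, [/\ calL A, U (gn A) & U (gn (tneg A))].

Definition consistent_fixpoint (U : set nat) : Prop :=
  [/\ U `<=` calD, consistent U & U = GU U].

Definition smallest_consistent_fixpoint (U : set nat) : Prop :=
  consistent_fixpoint U /\ forall V, consistent_fixpoint V -> U `<=` V.

Variables (L0 : language S) (U : set nat).

Definition DT : set (texpr S) := LU U `|` FU U.

Definition LT_sentence : set (texpr S) := (@EBase S @` sentence L0) `|` DT.

Definition LT_formula m : set (tformula S m) :=
  fun f => match f with
  | FBase _ P => is_formula L0 P \/ predicate L P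
  | FT _ => True
  | FTT _ _ => True
  | FTP _ _ P => predicate L P
  end.

Definition LT_term : set (term S) := is_term L `|` range (numeral S).

Definition LT_names (t : term S) (o : object S + texpr S) : Prop :=
  match o with
  | inl o => is_term L t /\ names L t o
  | inr A => calL A /\ t = [# A]
  end.

Definition LT_dom m (f : tformula S m) : 'I_m -> set (object S + texpr S) :=
  match f in tformula _ m return 'I_m -> set (object S + texpr S) with
  | FBase _ P => fun i => inl @` dom L P i
  | FT _ => fun _ => inr @` DT
  | FTT _ _ => fun _ => inr @` DT
  | FTP _ _ P => fun i => inl @` dom L P i
  end.

Lemma LU_sentence : LU U `<=` LT_sentence.
Proof. by move=> A hA; right; left. Qed.

Lemma FU_sentence : FU U `<=` LT_sentence.
Proof. by move=> A hA; right; right. Qed.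

Definition calLT : language (tsyntax gn) :=
  @Language (tsyntax gn) LT_sentence LT_formula LT_term LT_names LT_dom
    (LU U) (FU U) LU_sentence FU_sentence.

End Construction.

(* Main.v *)
Require Import Defs.
From mathcomp Require Import all_boot all_classical.

Set Implicit Arguments.
Unset Strict Implicit.
Unset Printing Implicit Defensive.

Local Open Scope classical_set_scope.

(** The theorem rests on two features of the set L(U) of true sentences.

    Consistency: since U is a fixed point of G and the Goedel numbering is
    injective, U consists of the numbers of the sentences of L(U), so the
    consistency of U says that L(U) never contains both A and ~A
    ([LU_consistent]).

    Completeness: write D_T for the union of L(U) and F(U).  The clauses that
    generate L(U) are the strong truth tables, so as soon as the parts of a
    compound are in D_T, the compound or its negation is put into L(U).

    Together they turn one-directional generation clauses into the two-sided
    truth rules: if a condition P forces A into L(U), a condition Q forces ~A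
    into L(U), and P or Q holds, then A is true exactly when P holds and false
    exactly when Q holds ([valuedI]).  In this way every rule is obtained
    without an analysis of how a given sentence can have entered L(U).  Each
    rule also shows that the compound is again in D_T, which is the set of all
    sentences of the new language ([LT_sentenceE]), so closure comes along.

    For T itself, the sentences T(n) and ~T(n) put into the initial stage make
    T([A]) true or false exactly as A is ([T_rule]).  This is where the fixed
    point is used a second time: membership of #A in U has become membership of
    A in L(U).  The truth predicate and non-truth predicate properties then
    follow from the rule for the biconditional.

    For quantified sentences ([quant_rule]) there are two situations.  If f is a
    predicate P of L, or T_1([P]), its instances have the same values as those
    of P or ~P in L, so the rule is inherited from L ([quant_valued_transfer]).
    If f is T_1 or T_1([T_2]), it has both true and false instances, because
    D_T contains both true and false sentences; hence the universal sentence has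
    to be false and the existential one true, as the initial stage declares
    ([quant_valued_unary]). *)

(** * Unions of iterates *)

Lemma subset_iter (T : Type) (f : set T -> set T) (X : set T) (m n : nat) :
  (forall Y, Y `<=` f Y) -> (m <= n)%N -> iter m f X `<=` iter n f X.
Proof.
move=> fY; elim: n => [|n IHn]; first by rewrite leqn0 => /eqP->.
rewrite leq_eqVlt => /predU1P[-> //|/IHn le_mn] x /le_mn; exact: fY.
Qed.

(** Two members of the union of an increasing chain lie in a common stage; this
    is what makes the union closed under rules with two premises. *)
Lemma bigcup_iter2 (T : Type) (f : set T -> set T) (X : set T) (x y : T) :
  (forall Y, Y `<=` f Y) ->
  (\bigcup_n iter n f X) x -> (\bigcup_n iter n f X) y ->
  exists n, iter n f X x /\ iter n f X y.
Proof.
move=> fY [m _ Xx] [n _ Xy]; exists (maxn m n); split.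
  by apply: (subset_iter fY (leq_maxl m n)).
by apply: (subset_iter fY (leq_maxr m n)).
Qed.

(** * Quantifier prefixes *)

Section BoundedQuantification.
Variable T : Type.

Lemma bounded_quant_sub m (q : m.-tuple quantifier) (N : 'I_m -> set T)
    (Q Q' : m.-tuple T -> Prop) :
  (forall b, (forall i, N i (tnth b i)) -> Q b -> Q' b) ->
  bounded_quant q N Q -> bounded_quant q N Q'.
Proof.
elim: m q N Q Q' => [|m IHm] q N Q Q' QQ' /=; first by apply: QQ' => -[].
(* extending a tuple over the tails by [t] keeps it within the domains *)
have QQ'b t : N ord0 t ->
    bounded_quant (behead_tuple q) (fun i => N (lift ord0 i))
      (fun b => Q (cons_tuple t b)) ->
    bounded_quant (behead_tuple q) (fun i => N (lift ord0 i))
      (fun b => Q' (cons_tuple t b)).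
  move=> Nt; apply: IHm => b Nb; apply: QQ' => i.
  by case: (unliftP ord0 i) => [j|] ->; rewrite ?tnthS ?tnth0.
case: (thead q) => [H t Nt|[t [Nt H]]]; first by apply: QQ'b (H t Nt).
by exists t; split=> //; apply: QQ'b.
Qed.

(** Classical duality: the dual prefix applied to [Q'] is what failure of the
    prefix applied to [Q] leaves when each instance satisfies [Q] or [Q']. *)
Lemma bounded_quant_dual m (q : m.-tuple quantifier) (N : 'I_m -> set T)
    (Q Q' : m.-tuple T -> Prop) :
  (forall b, (forall i, N i (tnth b i)) -> Q b \/ Q' b) ->
  bounded_quant q N Q \/ bounded_quant (map_tuple qdual q) N Q'.
Proof.
elim: m q N Q Q' => [|m IHm] q N Q Q' QQ' /=; first by apply: QQ' => -[].
have -> : thead (map_tuple qdual q) = qdual (thead q) by rewrite /thead tnth_map.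
have -> : behead_tuple (map_tuple qdual q) = map_tuple qdual (behead_tuple q).
  by apply: val_inj; rewrite /= behead_map.
pose rest t := bounded_quant (behead_tuple q) (fun i => N (lift ord0 i))
                 (fun b => Q (cons_tuple t b)).
pose rest' t := bounded_quant (map_tuple qdual (behead_tuple q))
                  (fun i => N (lift ord0 i)) (fun b => Q' (cons_tuple t b)).
have QQ'b t : N ord0 t -> rest t \/ rest' t.
  move=> Nt; apply: IHm => b Nb; apply: QQ' => i.
  by case: (unliftP ord0 i) => [j|] ->; rewrite ?tnthS ?tnth0.
case: (thead q) => /=.
  case: (pselect (exists t, N ord0 t /\ rest' t)) => [|nex]; first by right.
  by left=> t Nt; case: (QQ'b t Nt) => // r't; case: nex; exists t.
case: (pselect (exists t, N ord0 t /\ rest t)) => [|nex]; first by left.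
by right=> t Nt; case: (QQ'b t Nt) => // rt; case: nex; exists t.
Qed.

End BoundedQuantification.

(** * Membership in the sets of sentences *)

Section Valuation.
Variables (S : syntax) (L0 L : language S) (HL : basic_extension L0 L).
Variables (gn : texpr S -> nat) (Hgn : goedel_numbering L gn).
Variables (U : set nat) (HU : consistent_fixpoint L gn U).

Notation calL := (calL L).
Notation LU := (LU L gn U).
Notation FU := (FU L gn U).
Notation DT := (DT L gn U).
Notation "[# A ]" := (corner gn A).

Let rulesL : truth_rules L. Proof. by case: HL. Qed.
Let closL : closure_property L. Proof. by case: HL. Qed.
Let bivL : bivalent L. Proof. by case: HL. Qed.

Lemma calL_closed : calL_step calL `<=` calL.
Proof.
have incr (Y : set (texpr S)) : Y `<=` calL_step Y by move=> A; apply: calL_old.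
have two A B : calL A -> calL B -> exists n, calLn L n A /\ calLn L n B.
  exact: bigcup_iter2 incr.
move=> _ [A|A [n _ hA]|A B hA hB|A B hA hB|A B hA hB|A B hA hB] //.
  by exists n.+1 => //; apply: calL_neg.
all: have [n [An Bn]] := two _ _ hA hB; exists n.+1 => //=.
- exact: calL_disj.
- exact: calL_conj.
- exact: calL_impl.
- exact: calL_equi.
Qed.

Lemma calL_tneg A : calL A -> calL (tneg A).
Proof. by move=> hA; apply: calL_closed; apply: calL_neg. Qed.

Lemma calL_atomic A : calL0 L A -> calL A.
Proof. by exists 0%N. Qed.

(** No sentences over the old syntax are gained: a compound is an expression of
    S only if its parts are, and then L is closed under it. *)
Lemma calL_base a : calL (EBase a) -> sentence L a.
Proof.
have [cneg cbin _] := closL.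
pose good (A : texpr S) := if A is EBase a then sentence L a else True.
suff cgood n A : calLn L n A -> good A by case=> n _ /cgood.
elim: n A => [|n IHn] A; first by case=> // -[].
case=> [B|B|B C|B C|B C|B C] /IHn; first by [].
  by case: B => //= b /cneg.
all: by case: B => // b hb /IHn; case: C => //= c hc; case: (cbin b c hb hc).
Qed.

Lemma calL_lit s A : calL (tlit s [# A]).
Proof. exact/calL_atomic/calL0_T. Qed.

Lemma stage0_calL : stage0 L gn U `<=` calL.
Proof.
have atm := calL_atomic; have neg A := @calL_tneg A.
move=> A [[a ta <-]|[_ [[[[[|]|]|]|[|]]|[|]]]].
- by apply: atm; constructor; apply: true_sentence.
- by case=> B [hB UB ->]; apply: (calL_lit Pos).
- by case=> B [hB UB ->]; apply: (calL_lit Neg).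
- by case=> s [] ->; [apply: neg|]; apply: atm; constructor.
- by case=> s1 [s2 []] ->; [apply: neg|]; apply: atm; constructor.
- by case=> m [P [q [hP tP ->]]]; apply: atm; constructor.
- by case=> m [P [q [hP tP ->]]]; apply: neg; apply: atm; constructor.
- by case=> m [P [q [hP tP ->]]]; apply: atm; constructor.
- by case=> m [P [q [hP tP ->]]]; apply: neg; apply: atm; constructor.
Qed.

Lemma LU_calL : LU `<=` calL.
Proof.
move=> A [n _]; elim: n A => [|n IHn] A; first exact: stage0_calL.
case=> [B /IHn //|B hB _|B C hB hC _|B C hB hC _|B C hB hC _|B C hB hC _
       |B C hB hC _|B C hB hC _|B C hB hC _|B C hB hC _].
  by do 2 apply: calL_tneg.
all: try apply: calL_tneg; apply: calL_closed.
- exact: calL_disj.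
- exact: calL_conj.
- exact: calL_impl.
- exact: calL_equi.
- exact: calL_disj.
- exact: calL_conj.
- exact: calL_impl.
- exact: calL_equi.
Qed.

Lemma LU_closed : stage_step L LU `<=` LU.
Proof.
have incr (Y : set (texpr S)) : Y `<=` stage_step L Y by move=> A; apply: stage_old.
have two A B : LU A /\ LU B -> exists n, stage L gn U n A /\ stage L gn U n B.
  by case; apply: bigcup_iter2 incr.
move=> _ [X|A hA [n _ An]|A B hA hB|A B hA hB|A B hA hB|A B hA hB
        |A B hA hB|A B hA hB|A B hA hB|A B hA hB] //.
  by exists n.+1 => //; apply: stage_negneg.
- by case=> [/two|[/two|/two]] [n ?]; exists n.+1 => //; apply: stage_disj; tauto.
- by move=> /two[n ?]; exists n.+1 => //; apply: stage_conj.
- by case=> [/two|[/two|/two]] [n ?]; exists n.+1 => //; apply: stage_impl; tauto.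
- by case=> /two[n ?]; exists n.+1 => //; apply: stage_equi; tauto.
- by move=> /two[n ?]; exists n.+1 => //; apply: stage_neg_disj.
- case=> [/two|[/two|/two]] [n ?]; exists n.+1 => //; apply: stage_neg_conj; tauto.
- by move=> /two[n ?]; exists n.+1 => //; apply: stage_neg_impl.
- by case=> /two[n ?]; exists n.+1 => //; apply: stage_neg_equi; tauto.
Qed.

(** This makes consistency of U a statement about L(U). *)
Lemma in_U A : calL A -> U (gn A) <-> LU A.
Proof.
have [_ _ fixU] := HU => cA.
(* a plain rewrite would also unfold the U inside L(U) *)
rewrite {1}fixU; split=> [[B LB gnB]|LA]; last by exists A.
by rewrite -(Hgn (LU_calL LB) cA gnB).
Qed.

Lemma LU_consistent A : LU A -> ~ LU (tneg A).
Proof.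
have [_ consU _] := HU => LA LnA; apply: consU; exists A.
by have cA := LU_calL LA; split=> //; apply/in_U => //; apply: calL_tneg.
Qed.

(** * Truth values of compounds *)

(** The conjunct [DT A] makes a rule of this form serve closure as well, and
    provides the premise for the rule of the next compound. *)
Definition valued (A : texpr S) (P Q : Prop) : Prop :=
  DT A /\ (LU A <-> P) /\ (FU A <-> Q).

(** Consistency excludes the opposite value, so sufficient conditions for truth
    and for falsity that exhaust all cases are also necessary. *)
Lemma valuedI A (P Q : Prop) : calL A ->
  (P -> LU A) -> (Q -> LU (tneg A)) -> P \/ Q -> valued A P Q.
Proof.
move=> cA PA QA PQ; have cons := @LU_consistent A.
have FUE : FU A <-> LU (tneg A) by split=> [[]|].
by rewrite /valued FUE /Defs.DT /setU /=; tauto.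
Qed.

Lemma DT_calL A : DT A -> calL A.
Proof. by case=> [/LU_calL|[]]. Qed.

Lemma neg_rule A : DT A -> valued (tneg A) (FU A) (LU A).
Proof.
move=> dA; have cA := DT_calL dA; apply: valuedI.
- exact: calL_tneg.
- by case.
- by move=> LA; apply: LU_closed; apply: stage_negneg.
- by case: dA; [right|left].
Qed.

(* Each connective is settled by checking that the generation clauses cover all
   four combinations of the values of [A] and [B]. *)
Section Connectives.
Variables (A B : texpr S) (dA : DT A) (dB : DT B).

Let cA : calL A. Proof. exact: DT_calL. Qed.
Let cB : calL B. Proof. exact: DT_calL. Qed.
Let valA : LU A /\ LU A \/ FU A /\ LU (tneg A).
Proof. by case: dA => hA; [left|right; split=> //; case: hA]. Qed.
Let valB : LU B /\ LU B \/ FU B /\ LU (tneg B).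
Proof. by case: dB => hB; [left|right; split=> //; case: hB]. Qed.
Let nA : FU A -> LU (tneg A). Proof. by case. Qed.
Let nB : FU B -> LU (tneg B). Proof. by case. Qed.

Lemma disj_rule : valued (tdisj A B) (LU A \/ LU B) (FU A /\ FU B).
Proof.
apply: valuedI; last tauto; first by apply: calL_closed; apply: calL_disj.
  by move=> h; apply: LU_closed; apply: stage_disj => //; tauto.
by move=> h; apply: LU_closed; apply: stage_neg_disj => //; tauto.
Qed.

Lemma conj_rule : valued (tconj A B) (LU A /\ LU B) (FU A \/ FU B).
Proof.
apply: valuedI; last tauto; first by apply: calL_closed; apply: calL_conj.
  by move=> h; apply: LU_closed; apply: stage_conj => //; tauto.
by move=> h; apply: LU_closed; apply: stage_neg_conj => //; tauto.
Qed.

Lemma impl_rule : valued (timpl A B) (FU A \/ LU B) (LU A /\ FU B).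
Proof.
apply: valuedI; last tauto; first by apply: calL_closed; apply: calL_impl.
  by move=> h; apply: LU_closed; apply: stage_impl => //; tauto.
by move=> h; apply: LU_closed; apply: stage_neg_impl => //; tauto.
Qed.

Lemma equi_rule : valued (tequi A B)
  ((LU A /\ LU B) \/ (FU A /\ FU B)) ((LU A /\ FU B) \/ (FU A /\ LU B)).
Proof.
apply: valuedI; last tauto; first by apply: calL_closed; apply: calL_equi.
  by move=> h; apply: LU_closed; apply: stage_equi => //; tauto.
by move=> h; apply: LU_closed; apply: stage_neg_equi => //; tauto.
Qed.

End Connectives.

(** Bivalence of L decides every old sentence in the initial stage, so nothing
    added later can change its value. *)
Lemma base_rule a :
  sentence L a -> valued (EBase a) (is_true_in L a) (is_false_in L a).
Proof.
have Zsub x : is_true_in L x -> LU (EBase x).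
  by move=> tx; exists 0%N => //; left; exists x.
move=> sa; apply: valuedI; first exact/calL_atomic/calL0_base.
- exact: Zsub.
- by move=> fa; apply: Zsub; have [negL _] := rulesL; apply/(negL a sa).2.
- by case: (bivL sa).
Qed.

Lemma exists_LU : exists A, LU A.
Proof.
have [[[a sa] _ _ _] _ _ _ _] := HL.
by have [[LA|[_ LA]] _] := base_rule sa; [exists (EBase a)|exists (tneg (EBase a))].
Qed.

(** Needed because all clauses of the initial stage about T apply to nonempty
    sets only. *)
Lemma U_nonempty : U !=set0.
Proof. by have [A LA] := exists_LU; exists (gn A); apply/in_U => //; apply: LU_calL. Qed.

Lemma LU_stage0 X :
  (setZ1U L gn U `|` setZ2U L gn U `|` @setZ1 S `|` @setZ2 S `|`
       (setZ3 L `|` setZ3neg L) `|` (setZ4 L `|` setZ4neg L)) X -> LU X.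
Proof. by move=> hX; exists 0%N => //; right; split=> //; exact: U_nonempty. Qed.

(** The clauses Z_1(U) and Z_2(U) refer to #A and #[~A] being in U, which at the
    fixed point means that A is true or false. *)
Lemma T_rule A : DT A -> valued (ET [# A]) (LU A) (FU A).
Proof.
move=> dA; have cA := DT_calL dA; apply: valuedI => //.
- exact: (calL_lit Pos).
- by move=> LA; apply: LU_stage0; do 5 left; exists A; split=> //; apply/in_U.
- move=> [_ LA]; apply: LU_stage0; do 4 left; right; exists A; split=> //.
  by apply/in_U => //; apply: calL_tneg.
Qed.

Lemma lit_rule s A : DT A ->
  valued (tlit s [# A]) (if s is Pos then LU A else FU A)
                        (if s is Pos then FU A else LU A).
Proof.
move=> dA; have vT := T_rule dA; case: s => //=.
have [dN [tN fN]] := neg_rule vT.1; rewrite -[ENeg _]/(tneg (ET [# A])).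
by split=> //; split; [rewrite tN vT.2.2|rewrite fN vT.2.1].
Qed.

Lemma exists_FU : exists A, FU A.
Proof.
have [A LA] := exists_LU; exists (tneg A).
by have dA : DT A by [left]; apply/(neg_rule dA).2.2.
Qed.

(** The witnesses that refute a universal and verify an existential
    quantification of T or ~T. *)
Lemma exists_lit s :
  (exists2 A, DT A & LU (tlit s [# A])) /\ (exists2 A, DT A & FU (tlit s [# A])).
Proof.
have [A LA] := exists_LU; have [B FB] := exists_FU.
have dA : DT A by left.
have dB : DT B by right.
have [_ [tA fA]] := lit_rule s dA; have [_ [tB fB]] := lit_rule s dB.
by case: s tA fA tB fB => tA fA tB fB; split;
  solve [by exists A => //; apply/tA|by exists B => //; apply/tB
        |by exists A => //; apply/fA|by exists B => //; apply/fB].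
Qed.

(** The sentences T_2([A]) are themselves in D_T and take both values, so they
    can be put in place of A in the rule for T_1. *)
Lemma exists_litlit s1 s2 :
  (exists2 A, DT A & LU (tlit s1 [# tlit s2 [# A]])) /\
  (exists2 A, DT A & FU (tlit s1 [# tlit s2 [# A]])).
Proof.
have [[A dA tA] [B dB fB]] := exists_lit s2.
have [_ [tA' fA']] := lit_rule s1 (lit_rule s2 dA).1.
have [_ [tB' fB']] := lit_rule s1 (lit_rule s2 dB).1.
by case: s1 tA' fA' tB' fB' => tA' fA' tB' fB'; split;
  solve [by exists A => //; apply/tA'|by exists B => //; apply/tB'
        |by exists A => //; apply/fA'|by exists B => //; apply/fB'].
Qed.

(** Whichever of the two formulas is the syntactic negation of the other, the
    rule for negation in L exchanges their values. *)
Lemma fneg_rule m (P : formula S m) b : predicate L P ->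
    (forall i, term_dom L P i (tnth b i)) ->
  (is_true_in L (inst (fneg P) b) <-> is_false_in L (inst P b)) /\
  (is_false_in L (inst (fneg P) b) <-> is_true_in L (inst P b)).
Proof.
move=> hP hb; have [_ _ /(_ m P hP)[_ hnP domnP]] := closL.
have sP : sentence L (inst P b) by have [_ _ _] := hP; apply.
have snP : sentence L (inst (fneg P) b).
  have [_ _ _] := hnP; apply=> i.
  by have [tb [o Po bo]] := hb i; split=> //; exists o; rewrite ?domnP.
have [negL _] := rulesL.
case: (inst_fneg P) => eqP.
  have := negL _ sP; rewrite -eqP; tauto.
have := negL _ snP; rewrite -eqP; tauto.
Qed.

(** * Sentences, domains and predicates of the new language *)

Notation LT := (calLT L gn L0 U).

(** The sentences of L_0 contribute nothing new: as sentences of L they are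
    decided. *)
Lemma LT_sentenceE : sentence LT = DT.
Proof.
apply/seteqP; split=> A /=; last by right.
have [_ [sub _] _ _ _] := HL.
by case=> // -[a /sub sa <-]; exact: (base_rule sa).1.
Qed.

Lemma term_dom_base m (P : formula S m) i :
  @term_dom _ LT m (FBase P) i = term_dom L P i.
Proof.
apply/seteqP; split=> t /=.
  by case=> _ [_ [o Po <-] /= [ht hto]]; split=> //; exists o.
case=> ht [o Po hto]; split; first by left.
by exists (inl o) => //; exists o.
Qed.

Lemma term_dom_FTP m s (P : formula S m) i :
  @term_dom _ LT m (FTP s P) i = term_dom L P i.
Proof. exact: term_dom_base. Qed.

Lemma term_dom_DT (f : tformula S 1) :
    (exists s, f = FT s) \/ (exists s1 s2, f = FTT s1 s2) ->
  @term_dom _ LT 1 f ord0 = (corner gn) @` DT.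
Proof.
move=> hf; have -> : @term_dom _ LT 1 f ord0 = @term_dom _ LT 1 (FT Pos) ord0.
  by case: hf => [[s ->]|[s1 [s2 ->]]].
apply/seteqP; split=> t /=.
  by case=> _ [_ [A dA <-] /= [cA ->]]; exists A.
case=> A dA <-; split; first by right; exists (gn A).
by exists (inr A); [exists A|split=> //; apply: DT_calL].
Qed.

(** From left to right, a formula of L_0 might become a predicate only through
    sentences or names added to L; but the added sentences and names do not
    concern formulas and objects of S. *)
Lemma predicate_base m (P : formula S m) :
  @predicate _ LT m (FBase P) <-> predicate L P.
Proof.
have [_ [subS [subF _]] _ _ _] := HL.
split=> [[m_gt0 fP [D [domD Dn]] instP]|hP].
  split=> //.
  - by case: fP => [/subF //|[]].
  - exists (inl @^-1` D); split=> [i o Po|o /Dn].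
      by apply: (domD i); exists o.
    by case=> t _ /= [ht hto]; exists t.
  - move=> b hb; suff : sentence LT (@EBase S (inst P b)).
      by rewrite LT_sentenceE => /DT_calL/calL_base.
    by apply: instP => i; rewrite term_dom_base.
have [m_gt0 fP [D [domD Dn]] instP] := hP; split=> //.
- by right.
- exists (inl @` D); split=> [i _ [o Po <-]|_ [o /Dn[t ht hto] <-]].
    by exists o => //; apply: domD Po.
  by exists t => //; left.
- move=> b hb; rewrite LT_sentenceE; apply: (base_rule _).1; apply: instP => i.
  by rewrite -term_dom_base.
Qed.

Lemma predicate_FTP m s (P : formula S m) :
  @predicate _ LT m (FTP s P) <-> predicate L P.
Proof.
split=> [[_ //]|hP].
have [m_gt0 _ hD instP] := (predicate_base P).2 hP; split=> // b hb.
have [_ _ _ sP] := hP.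
rewrite LT_sentenceE; apply: (lit_rule s _).1; apply: (base_rule _).1.
by apply: sP => i; rewrite -(term_dom_FTP s).
Qed.

Lemma DT_named :
  exists D : set (object S + texpr S), (inr @` DT `<=` D) /\
    (forall o, D o -> exists2 t, is_term LT t & names LT t o).
Proof.
exists (inr @` DT); split=> // _ [A dA <-]; exists [# A]; first by right; exists (gn A).
by split=> //; apply: DT_calL.
Qed.

Lemma predicate_FT s : @predicate _ LT 1 (FT s).
Proof.
split=> //; first by have [D [? ?]] := DT_named; exists D; split.
move=> b /(_ ord0); rewrite term_dom_DT; last by left; exists s.
by case=> A dA eqb; rewrite LT_sentenceE /= /thead -eqb; exact: (lit_rule s dA).1.
Qed.

Lemma predicate_FTT s1 s2 : @predicate _ LT 1 (FTT s1 s2).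
Proof.
split=> //; first by have [D [? ?]] := DT_named; exists D; split.
move=> b /(_ ord0); rewrite term_dom_DT; last by right; exists s1, s2.
case=> A dA eqb; rewrite LT_sentenceE /= /thead -eqb.
exact: (lit_rule s1 (lit_rule s2 dA).1).1.
Qed.

(** * Quantified sentences *)

Definition quant_valued m (f : tformula S m) (q : m.-tuple quantifier) : Prop :=
  valued (tquant q f)
    (bounded_quant q (@term_dom _ LT m f) (fun b => LU (tinst gn f b)))
    (bounded_quant (map_tuple qdual q) (@term_dom _ LT m f)
       (fun b => FU (tinst gn f b))).

(** The instances of a predicate are in D_T, so by duality one of the two
    conditions always holds. *)
Lemma quant_valuedI m (f : tformula S m) (q : m.-tuple quantifier) :
    @predicate _ LT m f -> calL (tquant q f) ->
    (bounded_quant q (@term_dom _ LT m f) (fun b => LU (tinst gn f b)) ->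
       LU (tquant q f)) ->
    (bounded_quant (map_tuple qdual q) (@term_dom _ LT m f)
       (fun b => FU (tinst gn f b)) -> LU (tneg (tquant q f))) ->
  quant_valued f q.
Proof.
move=> [_ _ _ instf] cqf tq fq; apply: valuedI => //.
by apply: bounded_quant_dual => b /instf; rewrite LT_sentenceE.
Qed.

(** The truth rule of L for prefixes turns agreement of [f] with [P] on instances
    into agreement on the quantified sentences. *)
Lemma quant_valued_transfer m (f : tformula S m) (P : formula S m)
    (q : m.-tuple quantifier) :
    @predicate _ LT m f -> predicate L P -> calL (tquant q f) ->
    (forall i, @term_dom _ LT m f i = term_dom L P i) ->
    (forall b, (forall i, term_dom L P i (tnth b i)) ->
       valued (tinst gn f b) (is_true_in L (inst P b))
                             (is_false_in L (inst P b))) ->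
    (is_true_in L (quant q P) -> LU (tquant q f)) ->
    (is_false_in L (quant q P) -> LU (tneg (tquant q f))) ->
  quant_valued f q.
Proof.
have [_ [_ [_ [_ [_ quantL]]]]] := rulesL.
move=> hf hP cqf /funext domf instf tq fq; apply: quant_valuedI => //;
  rewrite domf => H; [apply/tq/(quantL m P q hP).1|apply/fq/(quantL m P q hP).2];
  apply: bounded_quant_sub H => b /instf[_ [tb fb]].
  by rewrite tb.
by rewrite fb.
Qed.

(** Since f has a true and a false instance, neither can the universal
    condition for truth hold nor the universal condition for falsity; so the
    declared value is the right one. *)
Lemma quant_valued_unary (f : tformula S 1) (q : 1.-tuple quantifier)
    (g : texpr S -> texpr S) :
    (exists s, f = FT s) \/ (exists s1 s2, f = FTT s1 s2) ->
    (forall A (b : 1.-tuple (term S)), thead b = [# A] -> tinst gn f b = g A) ->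
    (exists2 A, DT A & LU (g A)) -> (exists2 A, DT A & FU (g A)) ->
    @predicate _ LT 1 f -> calL (tquant q f) ->
    LU (if thead q is Qall then tneg (tquant q f) else tquant q f) ->
  quant_valued f q.
Proof.
move=> hf hg [A dA tA] [B dB fB] pf cqf.
have contra X : LU X -> FU X -> False by move=> /LU_consistent h [_ /h].
move=> hL; apply: quant_valuedI => //; rewrite /= (term_dom_DT hf); last first.
  have -> : thead (map_tuple qdual q) = qdual (thead q).
    by rewrite /thead tnth_map.
  case: (thead q) hL => //= _ H; case: (contra (g A)) => //.
  by rewrite -(hg A (cons_tuple [# A] [tuple])) //; apply: H; exists A.
case: (thead q) hL => //= _ H; case: (contra (g B)) => //.
by rewrite -(hg B (cons_tuple [# B] [tuple])) //; apply: H; exists B.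
Qed.

(** The predicate of L whose values T_1([P]) takes. *)
Definition signed_formula s m (P : formula S m) : formula S m :=
  if s is Pos then P else fneg P.

Lemma lit_inst_rule s m (P : formula S m) b : predicate L P ->
    (forall i, term_dom L P i (tnth b i)) ->
  valued (tinst gn (FTP s P) b) (is_true_in L (inst (signed_formula s P) b))
                                (is_false_in L (inst (signed_formula s P) b)).
Proof.
move=> hP hb; have [_ _ _ /(_ b hb) sPb] := hP.
have [dPb [tPb fPb]] := base_rule sPb; have [dl [tl fl]] := lit_rule s dPb.
have [tnP fnP] := fneg_rule hP hb.
split=> //; split; rewrite ?tl ?fl; case: (s) => /=; tauto.
Qed.

Lemma LU_quant_FTP s m (P : formula S m) (q : m.-tuple quantifier) :
    predicate L P ->
  (is_true_in L (quant q (signed_formula s P)) -> LU (EQTP q s P)) /\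
  (is_false_in L (quant q (signed_formula s P)) -> LU (tneg (EQTP q s P))).
Proof.
move=> hP; case: s => /=; split=> h; apply: LU_stage0.
- by left; right; left; exists m, P, q.
- by left; right; right; exists m, P, q.
- by right; left; exists m, P, q.
- by right; right; exists m, P, q.
Qed.

Lemma quant_rule m (f : tformula S m) (q : m.-tuple quantifier) :
  @predicate _ LT m f -> quant_valued f q.
Proof.
have [_ _ cquant] := closL.
case: f q => {m} [m P|s|s1 s2|m s P] q hf.
- have hP := (predicate_base P).1 hf; have [/(_ q) sq _ _] := cquant m P hP.
  have [_ _ _ sP] := hP; have [_ [tq fq]] := base_rule sq.
  apply: (@quant_valued_transfer m (FBase P) P q) => //.
  + exact/calL_atomic/calL0_base.
  + by move=> i; rewrite term_dom_base.
  + by move=> b hb; apply: base_rule; apply: sP.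
  + by move/tq.
  + by case/fq.
- have [tT fT] := exists_lit s.
  apply: (@quant_valued_unary (FT s) q (fun A => tlit s [# A])) => //.
  + by left; exists s.
  + by move=> A b /= ->.
  + exact/calL_atomic/calL0_QT.
  + apply: LU_stage0; do 3 left; right; exists s => /=.
    by case: (thead q); [left|right].
- have [tTT fTT] := exists_litlit s1 s2.
  apply: (@quant_valued_unary (FTT s1 s2) q
            (fun A => tlit s1 [# tlit s2 [# A]])) => //.
  + by right; exists s1, s2.
  + by move=> A b /= ->.
  + exact/calL_atomic/calL0_QTT.
  + apply: LU_stage0; do 2 left; right; exists s1, s2 => /=.
    by case: (thead q); [left|right].
- have hP := (predicate_FTP s P).1 hf; have [_ hnP domnP] := cquant m P hP.
  have tds i : term_dom L (signed_formula s P) i = term_dom L P i.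
    by case: s {hf} => //; rewrite /term_dom domnP.
  have [tq fq] := LU_quant_FTP s q hP.
  apply: (@quant_valued_transfer m (FTP s P) (signed_formula s P) q) => //.
  + by case: s {hf tds tq fq}.
  + exact/calL_atomic/calL0_QTP.
  + by move=> i; rewrite tds term_dom_FTP.
  + move=> b hb; apply: lit_inst_rule => // i; rewrite -tds; exact: hb.
Qed.

(** * The properties of the new language *)

Lemma closure_LT : closure_property LT.
Proof.
split; rewrite ?LT_sentenceE.
- by move=> A dA; exact: (neg_rule dA).1.
- move=> A B dA dB; split.
  + exact: (disj_rule dA dB).1.
  + exact: (conj_rule dA dB).1.
  + exact: (impl_rule dA dB).1.
  + exact: (equi_rule dA dB).1.
- move=> m P hP; split; first by move=> q; exact: (quant_rule q hP).1.
    have [_ _ cquant] := closL.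
    case: P hP => {m} [m P|s|s1 s2|m s P] /=.
    + by move/predicate_base/cquant => -[_ hnP _]; apply/predicate_base.
    + by move=> _; apply: predicate_FT.
    + by move=> _; apply: predicate_FTT.
    + by move/predicate_FTP => hP; apply/predicate_FTP.
  have [_ _ cquant] := closL.
  by case: P hP => {m} [m P /predicate_base/cquant[_ _ domnP] i|s|s1 s2|m s P] //=;
    rewrite domnP.
Qed.

Lemma truth_rules_LT : truth_rules LT.
Proof.
rewrite /truth_rules !LT_sentenceE.
split; first by move=> A dA; have [_ [t f]] := neg_rule dA; split; symmetry.
do 4?[split; first by move=> A B dA dB;
  first [exact: (disj_rule dA dB).2|exact: (conj_rule dA dB).2
        |exact: (impl_rule dA dB).2|exact: (equi_rule dA dB).2]].
by move=> m f q hf; exact: (quant_rule q hf).2.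
Qed.

Lemma bivalent_LT : bivalent LT.
Proof.
move=> A; rewrite LT_sentenceE => dA; split=> // -[LA [_ LnA]].
exact: LU_consistent LA LnA.
Qed.

Lemma naming_LT s : naming_of_sentences LT (FT s : formula (tsyntax gn) 1) (corner gn).
Proof.
move=> A; rewrite LT_sentenceE => dA; split; first by split=> //; apply: DT_calL.
by rewrite term_dom_DT; [exists A|left; exists s].
Qed.

Lemma truth_predicate_LT :
  truth_predicate (S := tsyntax gn) LT (FT Pos) (corner gn).
Proof.
split; [exact: predicate_FT|exact: naming_LT|move=> A; rewrite LT_sentenceE => dA].
have [dT [tT fT]] := T_rule dA.
by apply/(equi_rule dT dA).2.1; rewrite tT fT; case: dA; [left|right].
Qed.

Lemma nontruth_predicate_LT :
  nontruth_predicate (S := tsyntax gn) LT (FT Neg) (corner gn).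
Proof.
split; [exact: predicate_FT|exact: naming_LT|move=> A; rewrite LT_sentenceE => dA].
have [dN [tN fN]] := lit_rule Neg dA.
by apply/(equi_rule dN dA).2.2; rewrite tN fN; case: dA; [right|left].
Qed.

Lemma definitional_LT : definitional_theory_of_truth LT.
Proof.
split; first split; first by move=> A /bivalent_LT[].
  by exists (FT Pos), (corner gn); exact: truth_predicate_LT.
move=> A /bivalent_LT[[tA|fA] nboth]; [exists true|exists false]; split=> //.
  by case=> // fA; case: nboth.
by case=> // tA; case: nboth.
Qed.

End Valuation.

Theorem theorem5p1 (S : syntax) (L0 : language S)
    (HL0 : countable_language L0)
    (Hconf : conforms_to_classical_logic L0)
    (HnoT : ~ has_truth_predicate L0)
    (L : language S) (HL : basic_extension L0 L)
    (gn : texpr S -> nat) (Hgn : goedel_numbering L gn)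
    (U : set nat) (HU : smallest_consistent_fixpoint L gn U) :
  let LT := calLT L gn L0 U in
  closure_property LT /\
  truth_rules LT /\
  bivalent LT /\
  definitional_theory_of_truth LT /\
  truth_predicate (S := tsyntax gn) LT (FT Pos) (corner gn) /\
  nontruth_predicate (S := tsyntax gn) LT
    (fneg (s := tsyntax gn) (FT Pos)) (corner gn).
Proof.
have [fixU _] := HU.
split; first exact: closure_LT.
split; first exact: truth_rules_LT.
split; first exact: bivalent_LT.
split; first exact: definitional_LT.
split; [exact: truth_predicate_LT|exact: nontruth_predicate_LT].
Qed.
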